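(* Let $M=(V,E,T)$ be a triangulation of a closed Riemann surface, with finite vertex set $V$, edge set $E$ and triangle set $T$, together with a discrete metric $l:E\to(0,\infty)$, such that (1) the graph $(V,E)$ is strongly symmetric; (2) $M$ has no boundary, i.e. each edge lies in the boundary of exactly two triangles; (3) the discrete metric $l$ induces angles $\pi/3$ in each triangle. Let $l(\varepsilon)$ be a smooth family of discrete metrics on $M$, with $\varepsilon$ in an open interval around $0$ and $l(0)=l$. Let $\Delta_\varepsilon$ be the cotan-Laplace operator of $(M,l(\varepsilon))$ and let $\Delta'_\varepsilon$ be the local area normalized cotan-Laplace operator of $(M,l(\varepsilon))$. Then: (i) $$\left.\frac{d}{d\varepsilon}\right|_{\varepsilon=0}\log\det{}'\Delta_\varepsilon=0.$$ (ii) If moreover the total area of all triangles with respect to $l(\varepsilon)$ is independent of $\varepsilon$, then $$\left.\frac{d}{d\varepsilon}\right|_{\varepsilon=0}\log\det{}'\Delta'_\varepsilon=0.$$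
   Context: Edges are unordered pairs of distinct vertices and triangles are triples of vertices all of whose pairs are edges; $(V,E,T)$ is a triangulation (in the usual sense) of a closed surface. A discrete metric on $(V,E,T)$ is a function $l:E\to(0,\infty)$, written $l_{ij}=l(i,j)$, such that for each triangle $(i,j,k)\in T$ the strict triangle inequalities $l_{ij}<l_{jk}+l_{ki}$, $l_{jk}<l_{ki}+l_{ij}$, $l_{ki}<l_{ij}+l_{jk}$ hold. Each triangle of $T$ is thereby given the angles and the area of the Euclidean triangle with these side lengths. For an edge $(i,j)\in E$, let $\alpha_{ij},\beta_{ij}$ be the angles opposite to the edge $(i,j)$ in the two triangles containing that edge, and set $w_{ij}=\cot\alpha_{ij}+\cot\beta_{ij}$. Let $A_i$ be one third of the total area of all triangles having $i$ as a vertex. For $f:V\to\mathbb{R}$, the cotan-Laplace operator is $$(\Delta_{\rm cot}f)(i)=\sum_{j:(i,j)\in E}w_{ij}\,(f(i)-f(j)),$$ and the local area normalized cotan-Laplace operator is $$(\Delta'_{\rm cot}f)(i)=A_i^{-1}\sum_{j:(i,j)\in E}w_{ij}\,(f(i)-f(j)).$$ Both are identified with their $|V|\times|V|$ matrices after enumerating the vertices. For such an operator, $\det'$ denotes the product of its nonzero eigenvalues (counted with multiplicity). Strongly symmetric graphs: let $(V,E)$ be a finite connected graph with $E\neq\varnothing$. For $i,j\in V$ let $L(i,j)$ be the number of edges in a shortest path from $i$ to $j$, and for $s\in\mathbb{N}_0$ let $\alpha_s(i,j)$ be the number of neighbors $k$ of $i$ (vertices $k$ with $(i,k)\in E$) with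 $L(k,j)=s$. The graph is strongly symmetric if for every $s\in\mathbb{N}_0$ and all $i,j,v,w\in V$, $L(i,j)=L(v,w)$ implies $\alpha_s(i,j)=\alpha_s(v,w)$. *)

(* Defs.v *)
From HB Require Import structures.
From mathcomp Require Import all_boot all_order all_algebra.
From mathcomp Require Import complex.
From mathcomp Require Import all_classical all_reals all_analysis.

Set Implicit Arguments.
Unset Strict Implicit.
Unset Printing Implicit Defensive.

Import Order.TTheory GRing.Theory Num.Theory.
Import numFieldNormedType.Exports.

Local Open Scope ring_scope.

Section Graph.
Variables (V : finType) (E : {set {set V}}).

Definition adj : rel V := [rel i j | [set i; j] \in E].

(* The value is #|V| when j is not reachable from i. *)
Definition graph_dist (i j : V) : nat :=
  find (fun n => [exists p : n.-tuple V, path adj i p && (last i p == j)])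
    (iota 0 #|V|).

Definition alpha (s : nat) (i j : V) : nat :=
  #|[set k | adj i k & graph_dist k j == s]|.

Definition graph_connected : Prop := forall i j : V, connect adj i j.

Definition strongly_symmetric : Prop :=
  [/\ E != finset.set0, graph_connected &
      forall (s : nat) (i j v w : V),
        graph_dist i j = graph_dist v w -> alpha s i j = alpha s v w].

Lemma graph_distP (i j : V) : connect adj i j ->
  (exists2 p, path adj i p /\ last i p = j & size p = graph_dist i j) /\
  (forall p, path adj i p -> last i p = j -> (graph_dist i j <= size p)%N).
Proof.
pose a n := [exists p : n.-tuple V, path adj i p && (last i p == j)].
have aP p : path adj i p -> last i p = j -> a (size p).
  move=> pp lp; apply/existsP; exists (in_tuple p).
  by rewrite /= pp lp eqxx.
move=> /connectP[p0 pp0 lp0].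
have ha : has a (iota 0 #|V|).
  case/shortenP: pp0 lp0 => p pp up _ lp.
  apply/hasP; exists (size p); last exact: aP.
  rewrite mem_iota /= add0n.
  by have := max_card (mem (i :: p)); rewrite (card_uniqP up).
split=> [|p pp lp].
  have := nth_find 0%N ha.
  rewrite nth_iota; last by rewrite -[X in (_ < X)%N](size_iota 0) -has_find.
  rewrite add0n => /existsP[p /andP[pp /eqP lp]].
  by exists p; rewrite ?size_tuple.
rewrite leqNgt; apply/negP => lt.
have := before_find 0%N lt.
rewrite nth_iota; last first.
  by apply: leq_trans lt _; rewrite -[X in (_ <= X)%N](size_iota 0 #|V|) find_size.
by rewrite add0n [LHS]aP.
Qed.

End Graph.

Section Surface.
Variables (V : finType) (E T : {set {set V}}).

(* The link of v has vertices the neighbours of v and an edge {u, k} for each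
   triangle {v, u, k}; a nonempty connected 2-regular finite simple graph is a
   single cycle. *)
Definition link_is_cycle (v : V) : Prop :=
  [/\ exists u, adj E v u,
      forall u, adj E v u -> #|[set k | [set v; u; k] \in T]| = 2%N &
      forall u u', adj E v u -> adj E v u' ->
        connect [rel x y | [set v; x; y] \in T] u u'].

(* o i j k says that (i, j, k) is a positively ordered triple; triangles
   sharing the edge {i, j} must induce opposite directions on it. *)
Definition orientable : Prop :=
  exists o : V -> V -> V -> bool,
    [/\ forall i j k, [set i; j; k] \in T -> o j k i = o i j k,
        forall i j k, [set i; j; k] \in T -> o j i k = ~~ o i j k &
        forall i j k k', k != k' ->
          [set i; j; k] \in T -> [set i; j; k'] \in T ->
          o i j k' = ~~ o i j k].

Record surface_triangulation : Prop := SurfaceTriangulation {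
  edge_card : forall e, e \in E -> #|e| = 2%N;
  triangle_card : forall t, t \in T -> #|t| = 3%N;
  triangle_edges : forall t e : {set V},
    t \in T -> e \subset t -> #|e| = 2%N -> e \in E;
  triangulation_connected : graph_connected E;
  triangulation_link : forall v, link_is_cycle v;
  triangulation_orientable : orientable
}.

Definition no_boundary : Prop :=
  forall e, e \in E -> #|[set t in T | e \subset t]| = 2%N.

End Surface.

Section Metric.
Variables (R : realType) (V : finType) (E T : {set {set V}}).
Implicit Types (l : {set V} -> R).

(* An edge length function is total on {set V}; only its values on E matter. *)
Definition discrete_metric l : Prop :=
  (forall e, e \in E -> 0 < l e) /\
  (forall i j k, [set i; j; k] \in T ->
     l [set i; j] < l [set j; k] + l [set k; i]).

(* The angle at k of the triangle {i, j, k}, opposite to the edge {i, j},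
   given by the law of cosines. *)
Definition angle l (i j k : V) : R :=
  acos ((l [set j; k] ^+ 2 + l [set k; i] ^+ 2 - l [set i; j] ^+ 2)
        / (2 * l [set j; k] * l [set k; i])).

(* Heron's formula, the product being over the three edges of t. *)
Definition area l (t : {set V}) : R :=
  let s := (\sum_(e in E | e \subset t) l e) / 2 in
  Num.sqrt (s * \prod_(e in E | e \subset t) (s - l e)).

Definition total_area l : R := \sum_(t in T) area l t.

Definition cot (x : R) : R := cos x / sin x.

(* When T is made of 3-sets and each edge is in exactly two triangles, the sum
   has two terms for every edge {i, j}. *)
Definition weight l (i j : V) : R :=
  \sum_(k | [set i; j; k] \in T) cot (angle l i j k).

Definition vertex_area l (i : V) : R :=
  (\sum_(t in T | i \in t) area l t) / 3.

Definition cotan_laplace l (f : V -> R) (i : V) : R :=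
  \sum_(j | adj E i j) weight l i j * (f i - f j).

Definition normalized_cotan_laplace l (f : V -> R) (i : V) : R :=
  (vertex_area l i)^-1 * \sum_(j | adj E i j) weight l i j * (f i - f j).

(* Column b is the image of the indicator function of the b-th vertex. *)
Definition operator_matrix (D : (V -> R) -> V -> R) : 'M[R]_#|V| :=
  \matrix_(a, b) D (fun v => (v == enum_val b)%:R) (enum_val a).

End Metric.

Section Determinant.
Variable R : realType.

(* The complex eigenvalues, repeated according to algebraic multiplicity. *)
Definition eigenvalues n (A : 'M[R]_n) : seq R[i] :=
  sval (closed_field_poly_normal (char_poly (map_mx (real_complex R) A))).

Lemma eigenvaluesP n (A : 'M[R]_n) :
  char_poly (map_mx (real_complex R) A)
  = \prod_(z <- eigenvalues A) ('X - z%:P).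
Proof.
rewrite /eigenvalues; case: closed_field_poly_normal => s /= {1}->.
by rewrite (monicP (char_poly_monic _)) scale1r.
Qed.

(* The product is real because nonreal eigenvalues of a real matrix come in
   conjugate pairs; complex.Re only changes its type. *)
Definition det' n (A : 'M[R]_n) : R :=
  complex.Re (\prod_(z <- eigenvalues A | z != 0) z).

(* f is C^oo on the open set U. *)
Definition smooth_on (U : set R) (f : R -> R) : Prop :=
  forall (n : nat) (x : R), U x -> derivable (derive1n n f) x 1.

End Determinant.

(* Main.v *)
Require Import Defs.
From HB Require Import structures.
From mathcomp Require Import all_boot all_order all_algebra perm.
From mathcomp Require Import complex.
From mathcomp Require Import ring lra.
From mathcomp Require Import all_classical all_reals all_analysis.

Set Implicit Arguments.
Unset Strict Implicit.
Unset Printing Implicit Defensive.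

Import Order.TTheory GRing.Theory Num.Theory.
Import numFieldNormedType.Exports.

Local Open Scope ring_scope.

(** Both determinants are, up to explicit factors, the same function of the
    metric.  Let B be the matrix of the cotan-Laplace operator, n the number of
    vertices, J the all-ones n x n matrix and A_i the vertex areas.  Since B is
    symmetric and kills constants,
      det' B = det (B + J) / n   and
      det' (diag(A)^-1 B) = (prod_i A_i)^-1 (sum_i A_i) det (B + J) / n^2
    as long as the right-hand sides do not vanish ([det'_zero_row_sums],
    [det'_rescaled_zero_sums]).  So it suffices that det (B + J), and for fixed
    total area also prod_i A_i, are critical and nonzero at an equilateral
    metric.

    At such a metric all edges have the same length
    ([equiangular_const_length]), so all weights are equal and B = omega L with
    L the combinatorial Laplacian; by connectedness B + J is invertible
    ([constant_weight_det_neq0]).  By Jacobi's formula the logarithmic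
    derivative of det (B + J) is the trace of Z = (B + J)^-1 B', and Z solves
    omega L Z = B' with zero column sums.  The matrix B' lives on the diagonal
    and on the edges, its rows sum to zero, and the sum of all weights is
    critical ([sum_dweight]), because in an equilateral triangle each side is
    opposite to one angle and adjacent to two.  Therefore B' sums to zero over
    each set of pairs of vertices at a given distance, that is, B' is orthogonal
    to all functions of the distance.  Strong symmetry says that L maps
    functions of the distance to functions of the distance; as L is
    self-adjoint, averaging Z over the distance classes gives a solution of
    L M = 0, which must be constant, hence zero, and M has the trace of Z
    ([trace_laplace_preimage]).

    Finally all the A_i agree at the equilateral metric, since the graph is
    regular, so the logarithmic derivative of prod_i A_i is proportional to that
    of sum_i A_i, which is the total area ([is_derive_prod_vertex_area]). *)

(** * The product of the nonzero eigenvalues as a determinant *)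

(** The block matrix [M, -e; v, 1] has determinant det (M + e v), and right
    multiplication by [1, e; 0, c] makes it block triangular. *)
Lemma det_add_rank1 (K : comRingType) n (M : 'M[K]_n) (e : 'cV_n) (v : 'rV_n)
    (c : K) :
  M *m e = c *: e ->
  \det (M + e *m v) * c = \det M * (c + (v *m e) 0 0).
Proof.
move=> Me.
have E1 : block_mx M (- e) v 1%:M
    = block_mx 1%:M (- e) 0 1%:M *m block_mx (M + e *m v) 0 v 1%:M.
  by rewrite mulmx_block !mul1mx !mul0mx !mulmx1 mulNmx addrK !add0r.
have E2 : block_mx M (- e) v 1%:M *m block_mx 1%:M e 0 c%:M
    = block_mx M 0 v (v *m e + c%:M).
  by rewrite mulmx_block !mulmx1 !mulmx0 !addr0 mul1mx mul_mx_scalar Me scalerN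
    subrr.
have := congr1 determinant E2.
rewrite det_mulmx {1}E1 det_mulmx !det_ublock !det_lblock !det1 mulr1 !mul1r.
by rewrite !det_mx11 !mxE eqxx mulr1n mulr1 [c + _]addrC.
Qed.

Lemma char_poly_add_rank1 (K : comNzRingType) n (A : 'M[K]_n) (e : 'cV_n)
    (v : 'rV_n) :
  A *m e = 0 ->
  char_poly (A + e *m v) * 'X = char_poly A * ('X - ((v *m e) 0 0)%:P).
Proof.
move=> Ae; rewrite /char_poly.
have := @det_add_rank1 {poly K} n (char_poly_mx A) (map_mx polyC e)
  (- map_mx polyC v) 'X.
rewrite mulmxBl -map_mxM Ae map_mx0 subr0 mul_scalar_mx => /(_ erefl).
rewrite mulmxN mulNmx -!map_mxM !mxE -addrA -opprD -map_mxD /= => ->.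
by congr (_ * (_ - _)); rewrite !mxE.
Qed.

Section SimpleZero.
Variable R : realType.

(** If 0 is a simple eigenvalue then the coefficient of X in the
    characteristic polynomial is, up to sign, the product of the others. *)
Lemma det'_simple_zero n (A : 'M[R]_n) :
  (char_poly A)`_0 = 0 -> (char_poly A)`_1 != 0 ->
  det' A = (-1) ^+ n.-1 * (char_poly A)`_1.
Proof.
move=> c0 c1.
have E := eigenvaluesP A; rewrite -map_char_poly in E.
have s0 : 0 \in eigenvalues A.
  rewrite -root_prod_XsubC -E; apply/rootP.
  by rewrite horner_coef0 coef_map /= c0.
set r := rem 0 (eigenvalues A).
have pr := perm_to_rem s0; rewrite -/r in pr.
have sz : size r = n.-1.
  have := congr1 (fun p : {poly _} => size p) E.
  rewrite size_prod_XsubC size_map_poly size_char_poly (perm_size pr) /=.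
  by case=> ->.
move: E; rewrite (perm_big _ pr) /= big_cons subr0.
move=> /(congr1 (fun p : {poly _} => p`_1)).
rewrite coefXM /= coef_map /= -horner_coef0 horner_prod.
under eq_bigr do rewrite hornerXsubC sub0r.
have -> : \prod_(z <- r) - z = (-1) ^+ n.-1 * \prod_(z <- r) z.
  rewrite -sz; elim: (r) => [|z r' IH]; first by rewrite !big_nil mulr1.
  by rewrite !big_cons IH /= exprS; ring.
move=> c1E.
have rN0 z : z \in r -> z != 0.
  move=> zr; apply: contra_neq c1 => z0; move: c1E.
  rewrite (big_rem z) //= z0 mul0r mulr0 => /eqP.
  by rewrite fmorph_eq0 => /eqP.
rewrite /det' (perm_big _ pr) /= big_cons eqxx /=.
rewrite big_seq_cond (eq_bigl (fun z => z \in r)) => [|z]; last first.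
  by apply: andb_idr => /rN0.
rewrite -big_seq.
have -> : \prod_(z <- r) z = ((-1) ^+ n.-1 * (char_poly A)`_1)%:C%C.
  by rewrite rmorphM /= c1E rmorphXn /= rmorphN1 mulrA -expr2 sqrr_sign mul1r.
by [].
Qed.

(** Adding J to a matrix that kills constants replaces one zero eigenvalue by n
    and leaves the others unchanged. *)
Lemma det'_zero_row_sums n (A : 'M[R]_n) :
  (0 < n)%N -> A *m const_mx 1 = 0 :> 'cV_n -> \det (A + const_mx 1) != 0 ->
  det' A = n%:R^-1 * \det (A + const_mx 1).
Proof.
move=> n0 A1 d0.
have JE : const_mx 1 = (const_mx 1 : 'cV[R]_n) *m (const_mx 1 : 'rV[R]_n).
  by apply/matrixP=> i j; rewrite !mxE big_ord1 !mxE mulr1.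
have nE : ((const_mx 1 : 'rV[R]_n) *m (const_mx 1 : 'cV[R]_n)) 0 0 = n%:R.
  rewrite mxE; under eq_bigr do rewrite !mxE mulr1.
  by rewrite sumr_const card_ord.
have nn0 : n%:R != 0 :> R by rewrite pnatr_eq0 -lt0n.
have E := char_poly_add_rank1 (const_mx 1 : 'rV[R]_n) A1.
rewrite -JE nE in E.
have c0 : (char_poly A)`_0 = 0.
  have := congr1 (fun p : {poly _} => p`_0) E.
  rewrite coefMX /= mulrBr coefB coefMX /= sub0r coefMC => /eqP.
  by rewrite eq_sym oppr_eq0 mulf_eq0 (negbTE nn0) orbF => /eqP.
have c1 : (-1) ^+ n * \det (A + const_mx 1) = - ((char_poly A)`_1 * n%:R).
  have := congr1 (fun p : {poly _} => p`_1) E.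
  by rewrite coefMX /= mulrBr coefB coefMX /= c0 sub0r coefMC char_poly_det.
have c1E : (-1) ^+ n.-1 * (char_poly A)`_1 = n%:R^-1 * \det (A + const_mx 1).
  have -> : \det (A + const_mx 1) = (-1) ^+ n.-1 * ((char_poly A)`_1 * n%:R).
    have -> : (-1) ^+ n.-1 = - (-1) ^+ n :> R.
      by case: (n) n0 => // m _; rewrite exprS mulN1r opprK.
    by rewrite -[LHS](signrMK n) c1 mulrN mulNr.
  by field.
rewrite det'_simple_zero // -?c1E //.
apply/eqP=> z; move/eqP: c1; rewrite z mul0r oppr0 mulf_eq0 signr_eq0.
by rewrite (negbTE d0).
Qed.

(** With D the diagonal matrix of the [a i], D (D^-1 B + J) = B + a 1^T, and
    this is (1 + x 1^T) (B + J) for x = (a - 1) / n because B has zero column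
    sums. *)
Lemma det'_rescaled_zero_sums n (B : 'M[R]_n) (a : 'I_n -> R) :
  (0 < n)%N ->
  (forall i, \sum_j B i j = 0) -> (forall j, \sum_i B i j = 0) ->
  (forall i, a i != 0) -> \sum_i a i != 0 -> \det (B + const_mx 1) != 0 ->
  det' (\matrix_(i, j) ((a i)^-1 * B i j))
  = (\prod_i a i)^-1 * (\sum_i a i) * \det (B + const_mx 1) / n%:R ^+ 2.
Proof.
move=> n0 rB cB a0 sa d0.
have nn0 : n%:R != 0 :> R by rewrite pnatr_eq0 -lt0n.
set A := (\matrix_(i, j) _).
pose D : 'rV[R]_n := \row_i (a i)^-1.
pose x : 'cV[R]_n := \col_i ((a i - 1) / n%:R).
have AJ : A + const_mx 1
    = diag_mx D *m ((1%:M + x *m (const_mx 1 : 'rV_n)) *m (B + const_mx 1)).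
  apply/matrixP=> i j; rewrite mul_diag_mx !mxE.
  under eq_bigr do rewrite !mxE big_ord1 !mxE mulr1 mulrDl.
  rewrite big_split /= -mulr_sumr big_split /= cB add0r.
  rewrite sumr_const card_ord (bigD1 i) //= eqxx big1 ?addr0; last first.
    by move=> k /negbTE ki; rewrite eq_sym ki mul0r.
  by rewrite mul1r -mulrA mulVf // mulr1; field; rewrite a0.
have dx : \det (1%:M + x *m (const_mx 1 : 'rV_n)) = (\sum_i a i) / n%:R.
  have := @det_add_rank1 R n 1%:M x (const_mx 1) 1.
  rewrite mul1mx scale1r mulr1 => /(_ erefl) ->; rewrite det1 mul1r mxE.
  under eq_bigr do rewrite !mxE mul1r mulrBl.
  rewrite sumrB sumr_const card_ord -mulr_suml -[X in _ - X]mulr_natl mul1r.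
  rewrite mulfV //.
  by rewrite addrC subrK.
have dE : \det (A + const_mx 1)
    = (\prod_i a i)^-1 * ((\sum_i a i) / n%:R) * \det (B + const_mx 1).
  rewrite AJ !det_mulmx dx det_diag mulrA -prodfV.
  by under eq_bigr do rewrite mxE.
have pn0 : \prod_i a i != 0 by apply/prodf_neq0.
have dn0 : \det (A + const_mx 1) != 0.
  by rewrite dE !mulf_neq0 // ?invr_eq0.
rewrite det'_zero_row_sums //; first by rewrite dE; field; rewrite ?pn0 ?nn0.
apply/matrixP=> i j; rewrite !mxE; under eq_bigr do rewrite !mxE mulr1.
by rewrite -mulr_sumr rB mulr0.
Qed.
End SimpleZero.

(** * Derivatives of finite products, determinants and logarithms *)

Section Derivatives.
Variable R : realType.
Implicit Types (x : R) (f : R -> R).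

Lemma is_derive_bigsum (I : Type) (r : seq I) (P : pred I) (F : I -> R -> R)
    (dF : I -> R) x :
  (forall i, P i -> is_derive x (1 : R) (F i) (dF i)) ->
  is_derive x (1 : R) (fun y => \sum_(i <- r | P i) F i y)
    (\sum_(i <- r | P i) dF i).
Proof.
move=> dFP; elim: r => [|i r IH].
  rewrite big_nil; under [X in is_derive _ _ X]eq_fun do rewrite big_nil.
  exact: is_derive_cst.
rewrite big_cons; under [X in is_derive _ _ X]eq_fun do rewrite big_cons.
by case: ifP => // Pi; apply: is_deriveD => //; exact: dFP.
Qed.

Lemma is_derive_bigprod (I : finType) (F : I -> R -> R) (dF : I -> R) x :
  (forall i, is_derive x (1 : R) (F i) (dF i)) ->
  is_derive x (1 : R) (fun y => \prod_i F i y)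
    (\sum_i dF i * \prod_(j | j != i) F j x).
Proof.
move=> dFP.
elim: (index_enum I) (index_enum_uniq I) => [|i r IH] /=.
  rewrite big_nil; under [X in is_derive _ _ X]eq_fun do rewrite big_nil.
  by move=> _; exact: is_derive_cst.
move=> /andP[ir /IH{}IH].
under [X in is_derive _ _ X]eq_fun do rewrite big_cons.
apply: (is_derive_eq (is_deriveM (dFP i) IH)).
rewrite big_cons big_cons eqxx /= addrC /GRing.scale /= [_ * dF i]mulrC.
have neq j : j \in r -> j != i by apply: contraTneq => ->.
congr (_ * _ + _).
  rewrite big_seq [RHS]big_seq_cond; apply: eq_bigl => j.
  by case: (boolP (j \in r)) => // /neq ->.
rewrite mulr_sumr big_seq [RHS]big_seq; apply: eq_bigr => j /neq ji.
by rewrite big_cons eq_sym ji mulrCA.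
Qed.

(** Jacobi's formula. *)
Lemma is_derive_det n (F : 'I_n -> 'I_n -> R -> R) (dF : 'I_n -> 'I_n -> R) x :
  (forall i j, is_derive x (1 : R) (F i j) (dF i j)) ->
  is_derive x (1 : R) (fun y => \det (\matrix_(i, j) F i j y))
    (\sum_i \sum_j dF i j * cofactor (\matrix_(i, j) F i j x) i j).
Proof.
move=> dFP; rewrite /determinant.
have D (s : 'S_n) := is_derive_bigprod (fun i => dFP i (s i)).
have := @is_derive_bigsum _ (index_enum _) xpredT _ _ x
  (fun (s : 'S_n) _ => is_deriveZ ((-1) ^+ s) (D s)).
move=> H; apply: (@is_derive_eq _ _ _ _ _ _ _ (\sum_(s : 'S_n) (-1) ^+ s *:
  (\sum_i dF i (s i) * \prod_(j | j != i) F j (s j) x))).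
  congr (is_derive _ _ _ _): H; apply/funext => y; apply: eq_bigr => s _.
  by congr (_ * _); apply: eq_bigr => i _; rewrite mxE.
under eq_bigr do rewrite scaler_sumr.
rewrite exchange_big; apply: eq_bigr => i _.
rewrite (partition_big (fun s : 'S_n => s i) xpredT) //=; apply: eq_bigr => j _.
rewrite expand_cofactor mulr_sumr; apply: eq_bigr => s /eqP <-.
rewrite /GRing.scale /= mulrCA; congr (_ * (_ * _)).
by apply: eq_big => [k|k _]; rewrite ?mxE // eq_sym.
Qed.

Lemma is_derive_continuous f df x :
  is_derive x (1 : R) f df -> {for x, continuous f}.
Proof. by case=> /derivable1_diffP /differentiable_continuous. Qed.

Lemma is_derive_near_neq0 f df x :
  is_derive x (1 : R) f df -> f x != 0 -> \forall y \near x, f y != 0.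
Proof. by move=> /is_derive_continuous cf fx; apply: cvgr_neq0 cf fx. Qed.

(** On the nonpositive reals [ln] is constant. *)
Lemma is_derive_ln_critical f x :
  is_derive x (1 : R) f 0 -> f x != 0 ->
  is_derive x (1 : R) (fun y => ln (f y)) 0.
Proof.
move=> df; rewrite neq_lt => /orP[fx|fx]; last first.
  apply: (is_derive_eq (is_derive1_comp (is_derive1_ln fx) df)).
  by rewrite mulr0.
have d0 : is_derive x (1 : R) (cst 0 : R -> R) 0 by exact: is_derive_cst.
apply: near_eq_is_derive d0.
have := is_derive_continuous df => /cvgr_lt/(_ 0 fx).
by apply: filterS => y fy; rewrite /= ln0 // ltW.
Qed.

End Derivatives.

(** * The combinatorial Laplacian of a strongly symmetric graph *)

Section Laplacian.
Variables (R : realType) (V : finType) (e : rel V).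
Hypothesis e_sym : symmetric e.
Implicit Types f g : V -> R.

Definition laplacian f i : R := \sum_(j | e i j) (f i - f j).

Lemma laplacian_adjoint f g :
  \sum_i g i * laplacian f i = \sum_i laplacian g i * f i.
Proof.
have E (u w : V -> R) : \sum_i u i * laplacian w i
    = \sum_i \sum_(j | e i j) u i * w i - \sum_i \sum_(j | e i j) u i * w j.
  rewrite -sumrB; apply: eq_bigr => i _.
  by rewrite mulr_sumr -sumrB; apply: eq_bigr => j _; rewrite mulrBr.
under [RHS]eq_bigr do rewrite mulrC.
rewrite !E; congr (_ - _).
  by apply: eq_bigr => i _; apply: eq_bigr => j _; rewrite mulrC.
rewrite (exchange_big_dep xpredT) //=; apply: eq_bigr => i _.
apply: eq_big => [j|j _]; first by rewrite e_sym.
by rewrite mulrC.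
Qed.

Lemma dirichlet_energy f :
  2 * \sum_i f i * laplacian f i = \sum_i \sum_(j | e i j) (f i - f j) ^+ 2.
Proof.
have -> : \sum_i \sum_(j | e i j) (f i - f j) ^+ 2
    = \sum_i f i * laplacian f i + \sum_i \sum_(j | e i j) f j * (f j - f i).
  rewrite -big_split; apply: eq_bigr => i _ /=.
  by rewrite mulr_sumr -big_split; apply: eq_bigr => j _ /=; ring.
rewrite mulrDl !mul1r; congr (_ + _).
rewrite [RHS](exchange_big_dep xpredT) //=; apply: eq_bigr => i _.
by rewrite mulr_sumr; apply: eq_bigl => j; rewrite e_sym.
Qed.

(** A harmonic function has zero Dirichlet energy, so it is constant along
    edges. *)
Lemma harmonic_const f : (forall i j, connect e i j) ->
  (forall i, laplacian f i = 0) -> forall i j, f i = f j.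
Proof.
move=> e_conn lap0 i j.
have E0 : \sum_i \sum_(j | e i j) (f i - f j) ^+ 2 = 0.
  by rewrite -dirichlet_energy big1 ?mulr0 // => k _; rewrite lap0 mulr0.
have ef u w : e u w -> f u = f w.
  move=> euw; apply/eqP; rewrite -subr_eq0 -sqrf_eq0; apply/eqP.
  have s0 k : true -> 0 <= \sum_(j | e k j) (f k - f j) ^+ 2.
    by move=> _; apply: sumr_ge0 => *; exact: sqr_ge0.
  have sq0 k : e u k -> 0 <= (f u - f k) ^+ 2 by move=> _; exact: sqr_ge0.
  have rows0 := psumr_eq0P s0 E0.
  have terms0 := psumr_eq0P sq0 (rows0 u isT).
  exact: terms0.
case/connectP: (e_conn i j) => p.
elim: p i => [|u p IH] i /=; first by move=> _ ->.
by move=> /andP[/ef -> pp] /(IH _ pp).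
Qed.

End Laplacian.

Section StronglySymmetric.
Variables (R : realType) (V : finType) (E : {set {set V}}).
Hypothesis edge_card : forall e, e \in E -> #|e| = 2%N.
Hypothesis E_sym : strongly_symmetric E.
Local Notation L := (graph_dist E).
Local Notation lap := (@laplacian R V (adj E)).

Lemma adj_sym : symmetric (adj E).
Proof. by move=> i j; rewrite /adj /= finset.setUC. Qed.

Lemma adj_neq i j : adj E i j -> i != j.
Proof. by move=> /edge_card; rewrite cards2; case: (i == j). Qed.

Lemma graph_dist_eq0 i j : (L i j == 0%N) = (i == j).
Proof.
have [_ conn _] := E_sym.
have [[p [pp lp] sp] short] := graph_distP (conn i j).
apply/eqP/eqP => [L0|ij].
  by move: pp lp; rewrite (size0nil (etrans sp L0)).
by have := short [::] isT ij; rewrite leqn0 => /eqP.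
Qed.

Lemma graph_dist_refl i : L i i = 0%N.
Proof. by apply/eqP; rewrite graph_dist_eq0. Qed.

Lemma graph_dist_eq1 i j : (L i j == 1%N) = adj E i j.
Proof.
have [_ conn _] := E_sym.
have [[p [pp lp] sp] short] := graph_distP (conn i j).
apply/eqP/idP => [L1|aij].
  move: sp; rewrite [RHS]L1; case: p pp lp => [|k [|//]] //=.
  by rewrite andbT => ? <-.
apply/eqP; rewrite eqn_leq lt0n graph_dist_eq0 (adj_neq aij) andbT.
by apply: (short [:: j]); rewrite /= ?andbT.
Qed.

(** The degree of a vertex i is the number of its neighbours at distance 1 from
    i itself. *)
Lemma regular i j : #|[set k | adj E i k]| = #|[set k | adj E j k]|.
Proof.
have [_ _ /(_ 1%N i i j j)] := E_sym.
rewrite /alpha !graph_dist_refl => /(_ erefl).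
suff aE v : [set k | adj E v k & graph_dist E k v == 1%N] = [set k | adj E v k].
  by rewrite !aE.
apply/setP => k; rewrite !inE; apply: andb_idr => avk.
by rewrite graph_dist_eq1 adj_sym.
Qed.

Definition dist_invariant (g : V -> V -> R) : Prop :=
  forall i j v w, L i j = L v w -> g i j = g v w.

(** Strong symmetry says exactly that the span of the distance matrices is
    stable under multiplication by the adjacency matrix. *)
Lemma laplacian_dist_invariant g :
  dist_invariant g -> dist_invariant (fun i j => lap (g^~ j) i).
Proof.
have [_ _ sym] := E_sym.
move=> gL i j v w Lij.
(* g as a function of the distance, with value 0 at unattained distances *)
pose G s :=
  if [pick p : V * V | L p.1 p.2 == s] is Some p then g p.1 p.2 else 0.
have gE u k : g u k = G (L u k).
  rewrite /G; case: pickP => [p /eqP Lp|/(_ (u, k))]; first exact/esym/gL.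
  by rewrite eqxx.
have aE u k : \sum_(x | adj E u x) g x k
    = \sum_(s < #|V|.+1) G s *+ alpha E s u k.
  rewrite (partition_big (fun x => inord (L x k) : 'I_(#|V|.+1)) xpredT) //=.
  have LV x : (L x k < #|V|.+1)%N.
    by rewrite ltnS /graph_dist -[X in (_ <= X)%N](size_iota 0) find_size.
  apply: eq_bigr => s _; rewrite (eq_bigr (fun=> G s)); last first.
    by move=> x /andP[_ /eqP <-]; rewrite gE inordK.
  rewrite sumr_const; congr (_ *+ _); rewrite /alpha.
  by apply: eq_card => x; rewrite unfold_in /= inE -(inj_eq val_inj) /= inordK.
have deg u : \sum_(x | adj E u x) (1 : R) = \sum_(x | adj E i x) 1.
  have cardE v' : #|[set k | adj E v' k]| = #|adj E v'|.
    by apply: eq_card => k; rewrite inE.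
  by rewrite !sumr_const; have := regular u i; rewrite !cardE => ->.
rewrite /laplacian !sumrB !aE (gL _ _ _ _ Lij).
congr (_ - _); last by apply: eq_bigr => s _; rewrite (sym s _ _ _ _ Lij).
by rewrite -[g v w]mulr1 -!mulr_sumr (deg v).
Qed.

(** The average of Z over the pairs of vertices at the same distance, that is,
    its orthogonal projection to the distance-invariant matrices. *)
Definition dist_mean (Z : V -> V -> R) i j : R :=
  (\sum_(p : V * V | L p.1 p.2 == L i j) Z p.1 p.2)
  / (\sum_(p : V * V | L p.1 p.2 == L i j) 1).

Lemma dist_mean_invariant Z : dist_invariant (dist_mean Z).
Proof. by move=> i j v w Lij; rewrite /dist_mean Lij. Qed.

Lemma dist_mean_dot Z g : dist_invariant g ->
  \sum_(p : V * V) g p.1 p.2 * dist_mean Z p.1 p.2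
  = \sum_(p : V * V) g p.1 p.2 * Z p.1 p.2.
Proof.
move=> gL; rewrite /dist_mean.
under eq_bigr do rewrite mulr_suml mulr_sumr.
rewrite (exchange_big_dep xpredT) //=; apply: eq_bigr => q _.
pose c : R := \sum_(p : V * V | L p.1 p.2 == L q.1 q.2) 1.
have c0 : c != 0.
  rewrite /c sumr_const pnatr_eq0 -lt0n; apply/card_gt0P; exists q.
  by rewrite unfold_in; apply: eqxx.
rewrite (eq_bigr (fun=> g q.1 q.2 * Z q.1 q.2 / c * 1)); last first.
  by move=> p /eqP Lp; rewrite mulr1 (gL _ _ _ _ (esym Lp)) -Lp mulrA.
rewrite -mulr_sumr (eq_bigl (fun p => L p.1 p.2 == L q.1 q.2)).
  by rewrite mulfVK.
by move=> p; rewrite eq_sym.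
Qed.

Lemma pair_laplacian_adjoint (g Z : V -> V -> R) :
  \sum_(p : V * V) g p.1 p.2 * lap (Z^~ p.2) p.1
  = \sum_(p : V * V) lap (g^~ p.2) p.1 * Z p.1 p.2.
Proof.
rewrite -(pair_bigA _ (fun i j => g i j * lap (Z^~ j) i)).
rewrite -(pair_bigA _ (fun i j => lap (g^~ j) i * Z i j)) /=.
rewrite exchange_big [RHS]exchange_big; apply: eq_bigr => j _.
exact: (laplacian_adjoint adj_sym (Z^~ j) (g^~ j)).
Qed.

(** The average M of Z over distance classes is harmonic in its first argument:
    the Laplacian of M is distance-invariant, and it is orthogonal to the
    indicators of the distance classes because the Laplacian is self-adjoint.
    Hence M is constant, and as its sum vanishes it is zero. *)
Lemma trace_laplace_preimage (Z : V -> V -> R) :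
  (forall s, \sum_(p : V * V | L p.1 p.2 == s) lap (Z^~ p.2) p.1 = 0) ->
  \sum_i \sum_j Z i j = 0 -> \sum_i Z i i = 0.
Proof.
move=> lapZ sumZ.
have [Ene conn _] := E_sym.
set M := dist_mean Z.
have ML : dist_invariant M by exact: dist_mean_invariant.
pose ind s i j : R := (L i j == s)%:R.
have indL s : dist_invariant (ind s) by move=> i j v w; rewrite /ind => ->.
have indE s (F : V -> V -> R) : \sum_(p : V * V) ind s p.1 p.2 * F p.1 p.2
    = \sum_(p : V * V | L p.1 p.2 == s) F p.1 p.2.
  rewrite [RHS]big_mkcond; apply: eq_bigr => p _; rewrite /ind.
  by case: eqP; rewrite ?mul1r ?mul0r.
have lapM i j : lap (M^~ j) i = 0.
  have := pair_laplacian_adjoint (ind (L i j)) M.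
  rewrite (dist_mean_dot Z (laplacian_dist_invariant (indL _))).
  rewrite -pair_laplacian_adjoint !(indE _ (fun u w => lap (_^~ w) u)) lapZ.
  rewrite (eq_bigr (fun=> lap (M^~ j) i)); last first.
    by move=> p /eqP; exact: (laplacian_dist_invariant ML).
  rewrite sumr_const => /eqP; rewrite mulrn_eq0 => /orP[|/eqP//].
  by rewrite -leqn0 leqNgt => /negP[]; apply/card_gt0P; exists (i, j);
    rewrite unfold_in; exact: eqxx.
have Mjj i j : M i j = M j j.
  exact: (harmonic_const adj_sym conn (lapM^~ j)).
have MM i j u : M i j = M u u.
  by rewrite Mjj; apply: ML; rewrite !graph_dist_refl.
have sumM : \sum_(p : V * V) M p.1 p.2 = 0.
  have := dist_mean_dot Z (g := fun _ _ => 1) (fun _ _ _ _ _ => erefl).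
  under eq_bigr do rewrite mul1r.
  under [RHS]eq_bigr do rewrite mul1r.
  by rewrite -(pair_bigA _ Z) /= sumZ.
have M0 i j : M i j = 0.
  move: sumM; rewrite (eq_bigr (fun=> M i j)); last first.
    by move=> p _; rewrite (MM p.1 p.2 j) (MM i j j).
  rewrite sumr_const => /eqP; rewrite mulrn_eq0 => /orP[|/eqP//].
  by rewrite -leqn0 leqNgt => /negP[]; apply/card_gt0P; exists (i, j).
have := dist_mean_dot Z (indL 0%N).
rewrite !indE big1 => [|p _]; last exact: M0.
rewrite -(pair_big_dep xpredT (fun i j => L i j == 0%N)) /= => /esym.
under eq_bigr => i _ do under eq_bigl => j do rewrite graph_dist_eq0 eq_sym.
by under eq_bigr => i _ do rewrite big_pred1_eq.
Qed.

End StronglySymmetric.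

(** * The determinant of a weighted Laplacian at constant weights *)

Section WeightedLaplacian.
Variables (R : realType) (V : finType) (E : {set {set V}}).
Implicit Types (w : V -> V -> R) (f : V -> R).

Definition weighted_laplacian w f i : R :=
  \sum_(j | adj E i j) w i j * (f i - f j).

Local Notation mx w := (operator_matrix (weighted_laplacian w)).

Lemma sum_ord_V f : \sum_(a < #|V|) f (enum_val a) = \sum_i f i.
Proof. by rewrite -(big_enum_val f). Qed.

Lemma operator_mx_mul w f a :
  \sum_b mx w a b * f (enum_val b) = weighted_laplacian w f (enum_val a).
Proof.
have delta i : \sum_(b < #|V|) (i == enum_val b)%:R * f (enum_val b) = f i.
  rewrite (sum_ord_V (fun v => (i == v)%:R * f v)) (bigD1 i) //= eqxx mul1r.
  by rewrite big1 ?addr0 // => v /negbTE vi; rewrite eq_sym vi mul0r.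
rewrite /weighted_laplacian.
under eq_bigr do rewrite mxE mulr_suml.
rewrite exchange_big; apply: eq_bigr => j _ /=.
under eq_bigr do rewrite -mulrA mulrBl.
by rewrite -mulr_sumr sumrB !delta.
Qed.

Lemma weighted_laplacian_cst w c i : weighted_laplacian w (fun=> c) i = 0.
Proof. by apply: big1 => j _; rewrite subrr mulr0. Qed.

Lemma operator_mx_row_sum w a : \sum_b mx w a b = 0.
Proof.
have := operator_mx_mul w (fun=> 1) a.
by rewrite weighted_laplacian_cst; under eq_bigr do rewrite mulr1.
Qed.

Lemma sum_weighted_laplacian w f : (forall i j, w i j = w j i) ->
  \sum_i weighted_laplacian w f i = 0.
Proof.
move=> w_sym.
under eq_bigr => i _ do
  rewrite /weighted_laplacian (eq_bigr _ (fun _ _ => mulrBr _ _ _)) sumrB.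
rewrite sumrB [X in _ - X](exchange_big_dep xpredT) //=; apply/eqP.
rewrite subr_eq0; apply/eqP; apply: eq_bigr => i _.
by apply: eq_big => [j|j _]; [rewrite adj_sym | rewrite w_sym].
Qed.

Lemma operator_mx_col_sum w b : (forall i j, w i j = w j i) ->
  \sum_a mx w a b = 0.
Proof.
move=> w_sym.
rewrite -[RHS](sum_weighted_laplacian (fun v => (v == enum_val b)%:R) w_sym).
by rewrite -sum_ord_V; apply: eq_bigr => a _; rewrite mxE.
Qed.

End WeightedLaplacian.

Section Critical.
Variables (R : realType) (V : finType) (E : {set {set V}}).
Hypothesis edge_card : forall e, e \in E -> #|e| = 2%N.
Hypothesis E_sym : strongly_symmetric E.
Local Notation lap := (@laplacian R V (adj E)).
Local Notation mx w := (operator_matrix (weighted_laplacian E w)).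

Lemma constant_weight_laplacian w (omega : R) f i :
  (forall i j, adj E i j -> w i j = omega) ->
  weighted_laplacian E w f i = omega * lap f i.
Proof.
by move=> wE; rewrite /laplacian mulr_sumr; apply: eq_bigr => j /wE ->.
Qed.

Lemma card_V_gt0 : (0 < #|V|)%N.
Proof.
have [/set0Pn[e eE] _ _] := E_sym.
have : (0 < #|e|)%N by rewrite edge_card.
by move=> /leq_trans; apply; exact: max_card.
Qed.

Lemma card_V_neq0 : #|V|%:R != 0 :> R.
Proof. by rewrite pnatr_eq0 -lt0n card_V_gt0. Qed.

(** A vector f in the kernel satisfies [omega * lap f] + sum f = 0; summing over
    the vertices gives sum f = 0, so f is harmonic, constant, and zero. *)
Lemma constant_weight_det_neq0 w (omega : R) :
  omega != 0 -> (forall i j, w i j = w j i) ->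
  (forall i j, adj E i j -> w i j = omega) ->
  \det (mx w + const_mx 1) != 0.
Proof.
move=> omega0 w_sym wE; rewrite -det_tr; apply/negP => /det0P[v v0 /rowP Cv].
have [_ conn _] := E_sym.
pose f i := v 0 (enum_rank i).
have fv a : v 0 a = f (enum_val a) by rewrite /f enum_valK.
have Cf (a : 'I_#|V|) : omega * lap f (enum_val a) + \sum_i f i = 0.
  transitivity ((v *m (mx w + const_mx 1)^T) 0 a); last by rewrite Cv mxE.
  rewrite mxE.
  rewrite -(constant_weight_laplacian _ _ wE) -operator_mx_mul -(sum_ord_V f).
  by rewrite -big_split; apply: eq_bigr => b _ /=; rewrite !mxE fv; ring.
have S0 : \sum_i f i = 0.
  have : \sum_i (omega * lap f i + \sum_i f i) = 0.
    by apply: big1 => i _; rewrite -(enum_rankK i) Cf.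
  rewrite big_split /= sumr_const.
  under eq_bigr do rewrite -(constant_weight_laplacian _ _ wE).
  rewrite sum_weighted_laplacian // add0r => /eqP; rewrite mulrn_eq0.
  by rewrite eqn0Ngt card_V_gt0 => /eqP.
have lap0 i : lap f i = 0.
  have := Cf (enum_rank i); rewrite enum_rankK S0 addr0 => /eqP.
  by rewrite mulf_eq0 (negbTE omega0) => /eqP.
have fc := harmonic_const (@adj_sym _ E) conn lap0.
move/eqP: v0; apply; apply/rowP => a; rewrite mxE fv.
move: S0; rewrite (eq_bigr (fun=> f (enum_val a))) => [|i _]; last exact: fc.
by rewrite sumr_const => /eqP; rewrite mulrn_eq0 eqn0Ngt card_V_gt0 => /eqP.
Qed.

(** With C the matrix at [x] and D its derivative, Jacobi's formula gives the
    derivative [\det C] times the trace of Z = C^-1 D.  As the columns of D sum to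
    zero so do those of Z, hence [omega * lap] maps Z to D; and D sums to zero
    over every distance class: over the diagonal and over the edges since the
    [dw i j] sum to zero, elsewhere since D vanishes there. *)
Lemma is_derive_det_laplacian (w : R -> V -> V -> R) (dw : V -> V -> R)
    (omega x : R) :
  omega != 0 -> (forall y i j, w y i j = w y j i) ->
  (forall i j, adj E i j -> w x i j = omega) ->
  (forall i j, adj E i j -> is_derive x (1 : R) (fun y => w y i j) (dw i j)) ->
  (forall i j, dw i j = dw j i) -> \sum_i \sum_(j | adj E i j) dw i j = 0 ->
  is_derive x (1 : R) (fun y => \det (mx (w y) + const_mx 1)) 0.
Proof.
move=> omega0 w_sym wE dwP dw_sym sum_dw.
set C := mx (w x) + const_mx 1.
have uC : C \in unitmx.
  by rewrite unitmxE unitfE (constant_weight_det_neq0 omega0).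
set D := mx dw; pose Z := invmx C *m D.
have CZ : C *m Z = D by rewrite /Z mulKVmx.
pose z i j := Z (enum_rank i) (enum_rank j).
have ZE a b : Z a b = z (enum_val a) (enum_val b) by rewrite /z !enum_valK.
have colC k : \sum_a C a k = #|V|%:R.
  under eq_bigr do rewrite mxE [const_mx _ _ _]mxE.
  by rewrite big_split /= operator_mx_col_sum // add0r sumr_const card_ord.
have sumZ b : \sum_a Z a b = 0.
  have : \sum_a (C *m Z) a b = 0 by rewrite CZ operator_mx_col_sum.
  under eq_bigr do rewrite mxE.
  rewrite exchange_big /=.
  rewrite (eq_bigr (fun k => #|V|%:R * Z k b)) => [|k _]; last first.
    by rewrite -mulr_suml colC.
  by rewrite -mulr_sumr => /eqP; rewrite mulf_eq0 (negbTE card_V_neq0) => /eqP.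
have lapz a b : omega * lap (z^~ (enum_val b)) (enum_val a) = D a b.
  rewrite -CZ mxE -(constant_weight_laplacian _ _ wE) -operator_mx_mul.
  under [RHS]eq_bigr do rewrite mxE mulrDl [const_mx _ _ _]mxE mul1r.
  rewrite big_split /= sumZ addr0; apply: eq_bigr => k _.
  by rewrite ZE.
have trZ : \tr Z = 0.
  rewrite /mxtrace; under eq_bigr do rewrite ZE.
  rewrite (sum_ord_V (fun i => z i i)).
  apply: (trace_laplace_preimage edge_card E_sym); last first.
    rewrite exchange_big big1 // => j _; rewrite -(sum_ord_V (z^~ j)).
    rewrite -[RHS](sumZ (enum_rank j)).
    by apply: eq_bigr => a _; rewrite /z enum_valK.
  move=> s; apply: (mulfI omega0); rewrite mulr0 mulr_sumr.
  (* the (i, j) entry of D, for vertices instead of their ranks *)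
  rewrite (eq_bigr (fun p => \sum_(k | adj E p.1 k)
    dw p.1 k * ((p.1 == p.2)%:R - (k == p.2)%:R))); last first.
    move=> p _; have := lapz (enum_rank p.1) (enum_rank p.2).
    by rewrite mxE !enum_rankK => ->.
  have [->|[->|s2]] : s = 0%N \/ s = 1%N \/ (1 < s)%N.
    by case: s => [|[|s]]; [left | right; left | right; right].
  - rewrite (eq_bigl (fun p => p.1 == p.2)) => [|p]; last first.
      by rewrite graph_dist_eq0.
    rewrite -(pair_big_dep xpredT (fun i j => i == j)
      (fun i j => \sum_(k | adj E i k)
        dw i k * ((i == j)%:R - (k == j)%:R))) /=.
    rewrite -[RHS]sum_dw.
    apply: eq_bigr => i _; rewrite (big_pred1 i) => [|j]; last by rewrite eq_sym.
    apply: eq_bigr => k /(adj_neq edge_card); rewrite eqxx eq_sym => /negbTE ->.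
    by rewrite subr0 mulr1.
  - rewrite (eq_bigl (fun p => adj E p.1 p.2)) => [|p]; last first.
      by rewrite graph_dist_eq1.
    rewrite -(pair_big_dep xpredT (adj E)
      (fun i j => \sum_(k | adj E i k)
        dw i k * ((i == j)%:R - (k == j)%:R))) /=.
    rewrite -[RHS]oppr0 -[in RHS]sum_dw -sumrN.
    apply: eq_bigr => i _; rewrite -sumrN; apply: eq_bigr => j aij.
    rewrite (bigD1 j) //= eqxx (negbTE (adj_neq edge_card aij)) sub0r mulrN1.
    by rewrite big1 ?addr0 // => k /andP[_ /negbTE ->]; rewrite subr0 mulr0.
  - apply: big1 => p /eqP ps; apply: big1 => k aik.
    have -> : (p.1 == p.2) = false.
      apply/negP; rewrite -(graph_dist_eq0 E_sym) ps => /eqP s0.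
      by rewrite s0 in s2.
    case: eqP => kp; last by rewrite subr0 mulr0.
    move: aik; rewrite kp -(graph_dist_eq1 edge_card E_sym) ps => /eqP s1.
    by rewrite s1 in s2.
pose F a b y : R := mx (w y) a b + 1.
have dF a b : is_derive x (1 : R) (F a b) (D a b).
  have d1 : is_derive x (1 : R) (cst 1 : R -> R) 0 by exact: is_derive_cst.
  suff dmx : is_derive x (1 : R) (fun y => mx (w y) a b) (D a b).
    by rewrite -[D a b]addr0; exact: (is_deriveD dmx d1).
  rewrite mxE; under [X in is_derive _ _ X]eq_fun do rewrite mxE.
  apply: is_derive_bigsum => j aij.
  under [X in is_derive _ _ X]eq_fun do rewrite mulrC.
  by rewrite mulrC; apply: is_deriveZ; exact: dwP.
have FE y : \matrix_(a, b) F a b y = mx (w y) + const_mx 1.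
  by apply/matrixP => a b; rewrite [LHS]mxE [RHS]mxE [const_mx _ _ _]mxE.
have := is_derive_det dF.
under [X in is_derive _ _ X]eq_fun do rewrite FE.
move/is_derive_eq; apply; rewrite FE -/C.
transitivity (\tr (D *m \adj C)).
  apply: eq_bigr => a _; rewrite mxE; apply: eq_bigr => b _.
  by congr (_ * _); rewrite mxE.
by rewrite mxtrace_mulC -CZ mulmxA mul_adj_mx mul_scalar_mx mxtraceZ trZ mulr0.
Qed.

End Critical.

(** * Equiangular metrics *)

Section Triangles.
Variables (R : realType) (V : finType) (E T : {set {set V}}).
Hypothesis hM : surface_triangulation E T.

Lemma set3_rot (i j k : V) : [set i; j; k] = [set j; k; i].
Proof. by rewrite [RHS]finset.setUC finset.setUA. Qed.

Lemma set3_swap (i j k : V) : [set i; j; k] = [set j; i; k].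
Proof. by rewrite (finset.setUC [set i]). Qed.

Lemma triangle_adj i j k : [set i; j; k] \in T -> adj E i j.
Proof.
move=> tT; apply: (triangle_edges hM tT); first exact: finset.subsetUl.
rewrite cards2; case: eqP => // ij.
have := triangle_card hM tT; rewrite ij finset.setUid cards2.
by case: (_ == _).
Qed.

Lemma cosine_itv (a b c : R) : 0 < b -> 0 < c -> a < b + c -> b < c + a ->
  c < a + b -> -1 < (b ^+ 2 + c ^+ 2 - a ^+ 2) / (2 * b * c) < 1.
Proof.
move=> b0 c0 abc bca cab.
have bc0 : 0 < 2 * b * c by rewrite !mulr_gt0.
by rewrite ltr_pdivlMr // ltr_pdivrMr //; apply/andP; split; nra.
Qed.

(** The cosine rule gives (a - b) ((a + b)^2 - c^2) = 0. *)
Lemma isosceles (a b c : R) : 0 < a -> 0 < b -> 0 < c ->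
  a < b + c -> b < c + a -> c < a + b ->
  acos ((b ^+ 2 + c ^+ 2 - a ^+ 2) / (2 * b * c))
  = acos ((c ^+ 2 + a ^+ 2 - b ^+ 2) / (2 * c * a)) -> a = b.
Proof.
move=> a0 b0 c0 abc bca cab /(congr1 cos); rewrite !acosK; last 2 first.
- rewrite in_itv /=; have := cosine_itv c0 a0 bca cab abc.
  by move=> /andP[/ltW -> /ltW ->].
- rewrite in_itv /=; have := cosine_itv b0 c0 abc bca cab.
  by move=> /andP[/ltW -> /ltW ->].
have den0 (u v : R) : 0 < u -> 0 < v -> 2 * u * v != 0.
  by move=> u0 v0; rewrite gt_eqF // !mulr_gt0.
move/eqP; rewrite eqr_div ?den0 // => /eqP H.
have : (a - b) * ((a + b - c) * (a + b + c)) * (2 * c) = 0.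
  transitivity ((c ^+ 2 + a ^+ 2 - b ^+ 2) * (2 * b * c)
    - (b ^+ 2 + c ^+ 2 - a ^+ 2) * (2 * c * a)); first by ring.
  by rewrite H subrr.
have pos : 0 < (a + b - c) * (a + b + c) * (2 * c).
  by rewrite !mulr_gt0 ?subr_gt0 // !addr_gt0.
rewrite -mulrA => /eqP; rewrite mulf_eq0 subr_eq0 (gt_eqF pos) orbF.
by move/eqP.
Qed.

(** Triangles are equilateral, lengths propagate around a vertex by connectedness
    of its link, and between vertices by connectedness of the graph. *)
Lemma equiangular_const_length (l : {set V} -> R) (alpha : R) :
  discrete_metric E T l ->
  (forall i j k, [set i; j; k] \in T -> angle l i j k = alpha) ->
  forall i j v w, adj E i j -> adj E v w -> l [set i; j] = l [set v; w].
Proof.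
move=> [l0 l_tri] l_angle.
have side i j k : [set i; j; k] \in T -> l [set i; j] = l [set j; k].
  move=> t1; have t2 := t1; rewrite set3_rot in t2.
  have t3 := t2; rewrite set3_rot in t3.
  have := etrans (l_angle _ _ _ t1) (esym (l_angle _ _ _ t2)).
  by apply: isosceles; rewrite ?l0 ?l_tri //;
    [exact: triangle_adj t1 | exact: triangle_adj t2 | exact: triangle_adj t3].
have star v u u' : adj E v u -> adj E v u' -> l [set v; u] = l [set v; u'].
  move=> vu vu'; have [_ _ /(_ _ _ vu vu')] := triangulation_link hM v.
  case/connectP => p; elim: p u {vu} => [|x p IH] u /=; first by move=> _ ->.
  move=> /andP[t pp] /(IH _ pp) <-.
  by rewrite finset.setUC; apply: side; rewrite set3_swap.
move=> i j v w ij vw.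
case/connectP: (triangulation_connected hM i v) => p.
elim: p i j ij => [|u p IH] i j ij /=.
  by move=> _ vi; move: vw; rewrite vi; exact: star.
move=> /andP[iu pp] lp; rewrite (star _ _ _ ij iu) finset.setUC.
by apply: IH; rewrite // adj_sym.
Qed.
End Triangles.

(** * Areas *)

Section Area.
Variables (R : realType) (V : finType) (E T : {set {set V}}).
Hypothesis hM : surface_triangulation E T.

Lemma triangle_edge_count t : t \in T ->
  #|[set e in E | e \subset t]| = 3%N.
Proof.
move=> tT.
have -> : [set e in E | e \subset t]
    = [set e : {set V} | e \subset t & #|e| == 2%N].
  apply/setP => e; rewrite !inE andbC; apply: andb_id2l => et.
  apply/idP/eqP => [/(edge_card hM)//|e2].
  exact: (triangle_edges hM tT et e2).
by rewrite cards_draws (triangle_card hM tT).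
Qed.

Lemma sum_vertex_area (l : {set V} -> R) :
  \sum_i vertex_area E T l i = total_area E T l.
Proof.
rewrite /vertex_area -mulr_suml (exchange_big_dep (mem T)) /=; last first.
  by move=> i t _ /andP[].
rewrite mulr_suml; apply: eq_bigr => t tT.
rewrite (eq_bigl (mem t)) => [|i]; last by rewrite tT.
by rewrite sumr_const (triangle_card hM tT) -[X in X / _]mulr_natr mulfK.
Qed.

(** Both sides are half the number of pairs (u, t) with t a triangle at i and u a
    vertex of t other than i: a triangle at i has two such vertices, and an edge
    at i lies in two triangles. *)
Lemma vertex_triangle_count : no_boundary E T -> forall i,
  #|[set t in T | i \in t]| = #|[set k | adj E i k]|.
Proof.
move=> h2 i; apply/eqP; rewrite -(eqn_pmul2r (isT : (0 < 2)%N)); apply/eqP.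
transitivity (\sum_(t in T | i \in t) #|t :\ i|)%N.
  rewrite (eq_bigr (fun=> 2%N)) => [|t /andP[tT it]]; last first.
    by have := triangle_card hM tT; rewrite (cardsD1 i) it => -[].
  rewrite sum_nat_const; congr (_ * _)%N.
  by apply: eq_card => t; rewrite inE.
under eq_bigr do rewrite -sum1_card.
rewrite (exchange_big_dep (fun k => adj E i k)) /=; last first.
  move=> t k /andP[tT it]; rewrite !inE => /andP[ki kt].
  apply: (triangle_edges hM tT); last by rewrite cards2 eq_sym ki.
  by rewrite finset.subUset !finset.sub1set it.
rewrite (eq_bigr (fun=> 2%N)) => [|k ik]; last first.
  rewrite sum1_card -(h2 _ ik).
  apply: eq_card => t.
  rewrite !inE unfold_in /= !inE finset.subUset !finset.sub1set.
  have -> : k != i by rewrite eq_sym (adj_neq (edge_card hM)).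
  by rewrite andTb andbA.
by rewrite sum_nat_const; congr (_ * _)%N; apply: eq_card => k; rewrite inE.
Qed.

(** The radicand of [area]. *)
Definition heron (l : {set V} -> R) (t : {set V}) : R :=
  (\sum_(e in E | e \subset t) l e) / 2 *
  \prod_(e in E | e \subset t) ((\sum_(e in E | e \subset t) l e) / 2 - l e).

Lemma heron_equilateral (l : {set V} -> R) (ell : R) t : t \in T ->
  (forall e, e \in E -> l e = ell) ->
  heron l t = ell * 3 / 2 * (ell / 2) ^+ 3.
Proof.
move=> tT lE; rewrite /heron.
have -> : \sum_(e in E | e \subset t) l e = ell * 3.
  rewrite (eq_bigr (fun=> ell)) => [|e /andP[/lE]] //.
  rewrite sumr_const mulr_natr -(triangle_edge_count tT); congr (_ *+ _).
  by apply: eq_card => e; rewrite inE.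
rewrite (eq_bigr (fun=> ell / 2)) => [|e /andP[/lE -> _]]; last by field.
rewrite prodr_const -(triangle_edge_count tT); congr (_ * _ ^+ _).
by apply: eq_card => e; rewrite inE.
Qed.

Lemma derivable_area (l : R -> {set V} -> R) (ell x : R) t : t \in T ->
  0 < ell -> (forall e, e \in E -> l x e = ell) ->
  (forall e, e \in E -> derivable (l^~ e) x 1) ->
  derivable (fun y => area E (l y) t) x 1.
Proof.
move=> tT ell0 lE dl.
have hx0 : 0 < heron (l x) t.
  by rewrite (heron_equilateral tT lE) mulr_gt0 ?exprn_gt0 ?divr_gt0 ?mulr_gt0.
have dlP e : e \in E -> is_derive x (1 : R) (l^~ e) ('D_1 (l^~ e) x).
  by move=> /dl /derivableP.
have ds : is_derive x (1 : R)
    (fun y => (\sum_(e in E | e \subset t) l y e) / 2)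
    (2^-1 * (\sum_(e in E | e \subset t) 'D_1 (l^~ e) x)).
  under [X in is_derive _ _ X]eq_fun do rewrite mulrC.
  by apply: is_deriveZ; apply: is_derive_bigsum => e /andP[/dlP].
have dfac e : derivable (fun y => if (e \in E) && (e \subset t)
    then (\sum_(e in E | e \subset t) l y e) / 2 - l y e else 1) x 1.
  case: (boolP (_ && _)) => [/andP[/dlP de _]|_]; last exact: derivable_cst.
  by have D := is_deriveB ds de; exact: ex_derive.
have dprod := is_derive_bigprod (fun e => derivableP (dfac e)).
have dheron : derivable (fun y => heron (l y) t) x 1.
  rewrite /heron; under eq_fun do rewrite [X in _ * X]big_mkcond.
  by have D := is_deriveM ds dprod; exact: ex_derive.
have D := @is_derive1_comp _ Num.sqrt (fun y => heron (l y) t) _ _ _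
  (is_derive1_sqrt hx0) (derivableP dheron).
exact: ex_derive.
Qed.
End Area.

(** * Cotangents of angles *)

Section Cotangent.
Variable R : realType.

Lemma is_derive_cot (u : R) : sin u != 0 ->
  is_derive u (1 : R) (@cot R) (- (sin u) ^- 2).
Proof.
move=> su.
apply: (is_derive_eq (is_deriveM (is_derive_cos u)
  (is_deriveV su (is_derive_sin u)))).
rewrite /GRing.scale /= -[in RHS](mul1r (sin u ^- 2)) -(cos2Dsin2 u).
by field.
Qed.

Lemma sin_acos_half : sin (acos (2^-1 : R)) != 0.
Proof.
rewrite sin_acos; last by apply/andP; split; lra.
by rewrite gt_eqF // sqrtr_gt0; lra.
Qed.

Lemma cot_acos_half : cot (acos (2^-1 : R)) != 0.
Proof.
rewrite /cot acosK; last by rewrite in_itv /=; apply/andP; split; lra.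
by rewrite mulf_neq0 ?invr_eq0 ?sin_acos_half.
Qed.

(** The derivative of the cotangent as a function of the cosine, at the value 1/2
    taken in equilateral triangles. *)
Definition dcot : R :=
  - (sin (acos (2^-1 : R))) ^- 2 * - (Num.sqrt (1 - 2^-1 ^+ 2))^-1.

Lemma cosine_rule_equilateral (ell : R) : ell != 0 ->
  (ell ^+ 2 + ell ^+ 2 - ell ^+ 2) / (2 * ell * ell) = 2^-1.
Proof. by move=> ell0; field. Qed.

Lemma is_derive_cot_angle (a b c : R -> R) (da db dc ell x : R) :
  is_derive x (1 : R) a da -> is_derive x (1 : R) b db ->
  is_derive x (1 : R) c dc ->
  a x = ell -> b x = ell -> c x = ell -> ell != 0 ->
  is_derive x (1 : R) (fun y => cot (acos
    ((b y ^+ 2 + c y ^+ 2 - a y ^+ 2) / (2 * b y * c y))))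
    (dcot / (2 * ell) * (db + dc - 2 * da)).
Proof.
move=> Da Db Dc ax bx cx ell0.
have dnum := is_deriveB (is_deriveD (is_deriveX 2 Db) (is_deriveX 2 Dc))
  (is_deriveX 2 Da).
have dden := is_deriveM (is_deriveZ 2 Db) Dc.
have den0 : ((2 \*: b : R -> R) * c) x != 0.
  by rewrite /GRing.mul /= bx cx !mulf_neq0.
have dq := is_deriveM dnum (is_deriveV den0 dden).
set q := fun y => (b y ^+ 2 + c y ^+ 2 - a y ^+ 2) / (2 * b y * c y).
have {}dq : is_derive x (1 : R) q ((db + dc - 2 * da) / (2 * ell)).
  apply: (is_derive_eq dq).
  transitivity ((b x ^+ 2 + c x ^+ 2 - a x ^+ 2)
      * (- (2 * b x * c x) ^- 2 * (2 * b x * dc + c x * (2 * db)))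
    + (2 * b x * c x)^-1 * (2 * b x * db + 2 * c x * dc - 2 * a x * da)).
    by [].
  by rewrite ax bx cx; field.
have qx : q x = 2^-1 by rewrite /q ax bx cx cosine_rule_equilateral.
have dacos : is_derive (q x) (1 : R) acos (- (Num.sqrt (1 - 2^-1 ^+ 2))^-1).
  by rewrite qx; apply: is_derive1_acos; apply/andP; split; lra.
have dcotP : is_derive (acos (q x)) (1 : R) (@cot R)
    (- (sin (acos (2^-1 : R))) ^- 2).
  by rewrite qx; exact: is_derive_cot sin_acos_half.
have D := is_derive1_comp dcotP (is_derive1_comp dacos dq).
apply: (is_derive_eq D); rewrite /dcot.
by move: (- sin _ ^- 2) (- (Num.sqrt _)^-1) => u v; field.
Qed.
End Cotangent.

(** * Criticality at an equilateral metric *)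

Section Main.
Variables (R : realType) (V : finType) (E T : {set {set V}}).
Hypothesis hM : surface_triangulation E T.
Implicit Types l : {set V} -> R.

Lemma angle_sym l i j k : angle l i j k = angle l j i k.
Proof.
rewrite /angle (finset.setUC [set j] [set k]) (finset.setUC [set k] [set i]).
by rewrite (finset.setUC [set i] [set j]) [X in X - _]addrC mulrAC.
Qed.

Lemma weight_sym l i j : weight T l i j = weight T l j i.
Proof.
rewrite /weight; apply: eq_big => [k|k _]; first by rewrite set3_swap.
by rewrite angle_sym.
Qed.

(** The derivative of [weight] at the equilateral metric of side [ell], when the
    edge lengths vary with velocity [b]. *)
Definition dweight (ell : R) (b : {set V} -> R) i j : R :=
  \sum_(k | [set i; j; k] \in T)
    dcot R / (2 * ell) * (b [set j; k] + b [set k; i] - 2 * b [set i; j]).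

Lemma dweight_sym ell b i j : dweight ell b i j = dweight ell b j i.
Proof.
rewrite /dweight; apply: eq_big => [k|k _]; first by rewrite set3_swap.
rewrite (finset.setUC [set j] [set k]) (finset.setUC [set k] [set i]).
by rewrite (finset.setUC [set i] [set j]) [X in X - _]addrC.
Qed.

(** In each triangle every side is opposite to one angle and adjacent to two, so
    the sum over all corners cancels. *)
Lemma sum_dweight ell b :
  \sum_i \sum_(j | adj E i j) dweight ell b i j = 0.
Proof.
pose S (f : V -> V -> V -> R) :=
  \sum_i \sum_j \sum_k (if [set i; j; k] \in T then f i j k else 0).
have S_rot f : S (fun i j k => f j k i) = S f.
  rewrite /S exchange_big; apply: eq_bigr => j _.
  rewrite exchange_big; apply: eq_bigr => k _; apply: eq_bigr => i _.
  by rewrite set3_rot.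
have -> : \sum_i \sum_(j | adj E i j) dweight ell b i j
    = S (fun i j k => dcot R / (2 * ell) *
        (b [set j; k] + b [set k; i] - 2 * b [set i; j])).
  apply: eq_bigr => i _; rewrite big_mkcond; apply: eq_bigr => j _.
  rewrite /dweight big_mkcond; case: ifP => // ij.
  rewrite big1 // => k _; case: ifP => // /(triangle_adj hM).
  by rewrite ij.
have S_lin (c : R) f g h :
    S (fun i j k => c * (f i j k + g i j k - 2 * h i j k))
    = c * (S f + S g - 2 * S h).
  rewrite /S mulrBr mulrDr mulrA !mulr_sumr -!(big_split, sumrB) /=.
  apply: eq_bigr => i _; rewrite !mulr_sumr -!(big_split, sumrB).
  apply: eq_bigr => j _; rewrite !mulr_sumr -!(big_split, sumrB).
  by apply: eq_bigr => k _; case: ifP => _ /=; ring.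
have r1 : S (fun i j k => b [set k; i]) = S (fun i j k => b [set j; k]).
  exact: (S_rot (fun i j k => b [set j; k])).
have r2 : S (fun i j k => b [set j; k]) = S (fun i j k => b [set i; j]).
  exact: (S_rot (fun i j k => b [set i; j])).
by rewrite S_lin r1 r2; ring.
Qed.

Section AtEquilateral.
Variables (l : R -> {set V} -> R) (ell x : R).
Hypothesis ell0 : 0 < ell.
Hypothesis lE : forall e, e \in E -> l x e = ell.
Hypothesis dl : forall e, e \in E -> derivable (l^~ e) x 1.

Lemma triangle_sides i j k : [set i; j; k] \in T ->
  [/\ [set i; j] \in E, [set j; k] \in E & [set k; i] \in E].
Proof.
move=> t1; have t2 := t1; rewrite set3_rot in t2.
have t3 := t2; rewrite set3_rot in t3.
by split; [exact: (triangle_adj hM t1) | exact: (triangle_adj hM t2)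
  | exact: (triangle_adj hM t3)].
Qed.

Lemma weight_equilateral i j : adj E i j ->
  weight T (l x) i j = 2 * cot (acos 2^-1).
Proof.
move=> ij; have [_ /(_ j ij) k2 _] := triangulation_link hM i.
rewrite /weight (eq_bigr (fun=> cot (acos 2^-1))) => [|k]; last first.
  move=> /triangle_sides[e1 e2 e3].
  by rewrite /angle !lE // cosine_rule_equilateral // gt_eqF.
rewrite sumr_const mulr_natl; congr (_ *+ _); rewrite -[RHS]k2.
by apply: eq_card => k; rewrite inE.
Qed.

Lemma is_derive_weight i j :
  is_derive x (1 : R) (fun y => weight T (l y) i j)
    (dweight ell (fun e => 'D_1 (l^~ e) x) i j).
Proof.
apply: is_derive_bigsum => k /triangle_sides[e1 e2 e3].
apply: is_derive_cot_angle; rewrite ?lE ?gt_eqF //;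
  by apply: derivableP; exact: dl.
Qed.

Hypothesis E_sym : strongly_symmetric E.

Local Notation B y := (operator_matrix (cotan_laplace E T (l y))).
Local Notation h y := (\det (B y + const_mx 1)).

Lemma is_derive_det_cotan : is_derive x (1 : R) (fun y => h y) 0.
Proof.
apply: (is_derive_det_laplacian (edge_card hM) E_sym
  (w := fun y => weight T (l y)) (omega := 2 * cot (acos 2^-1))).
- by rewrite mulf_neq0 ?cot_acos_half.
- by move=> y i j; exact: weight_sym.
- exact: weight_equilateral.
- by move=> i j _; exact: is_derive_weight.
- exact: dweight_sym.
- exact: sum_dweight.
Qed.

Lemma det_cotan_neq0 : h x != 0.
Proof.
apply: (constant_weight_det_neq0 (edge_card hM) E_sym
  (omega := 2 * cot (acos 2^-1))).
- by rewrite mulf_neq0 ?cot_acos_half.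
- exact: weight_sym.
- exact: weight_equilateral.
Qed.

Lemma log_det'_cotan_critical :
  is_derive x (1 : R) (fun y => ln (det' (B y))) 0.
Proof.
have n0 := card_V_neq0 R (edge_card hM) E_sym.
have dh : is_derive x (1 : R) (fun y => #|V|%:R^-1 * h y) 0.
  by rewrite -[X in is_derive _ _ _ X](mulr0 #|V|%:R^-1);
    apply: is_deriveZ; exact: is_derive_det_cotan.
have gx : #|V|%:R^-1 * h x != 0 by rewrite mulf_neq0 ?invr_eq0 ?det_cotan_neq0.
apply: near_eq_is_derive (is_derive_ln_critical dh gx).
have := is_derive_near_neq0 is_derive_det_cotan det_cotan_neq0.
apply: filterS => y hy; congr ln; apply/esym.
apply: det'_zero_row_sums => //; first exact: card_V_gt0 (edge_card hM) E_sym.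
apply/matrixP => a b; rewrite mxE [RHS]mxE.
rewrite -[RHS](operator_mx_row_sum E (weight T (l y)) a).
by apply: eq_bigr => c _; rewrite [const_mx _ _ _]mxE mulr1.
Qed.

Hypothesis M_closed : no_boundary E T.
Local Notation A y i := (vertex_area E T (l y) i).

Lemma vertex_area_equilateral :
  exists2 a, a != 0 & forall i, A x i = a.
Proof.
have [/set0Pn[e eE] _ _] := E_sym.
have /card_gt0P[i0 _] : (0 < #|e|)%N by rewrite (edge_card hM).
pose area0 := Num.sqrt (ell * 3 / 2 * (ell / 2) ^+ 3).
have AE i : A x i = area0 *+ #|[set k | adj E i k]| / 3.
  rewrite /vertex_area (eq_bigr (fun=> area0)) => [|t /andP[tT _]]; last first.
    by rewrite /area0 -(heron_equilateral hM tT lE).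
  rewrite sumr_const -(vertex_triangle_count hM M_closed); congr (_ *+ _ / _).
  by apply: eq_card => t; rewrite inE.
exists (A x i0) => [|i]; last first.
  by rewrite !AE (regular (edge_card hM) E_sym i i0).
rewrite AE mulf_neq0 ?invr_eq0 //.
have [[u i0u] _ _] := triangulation_link hM i0.
rewrite mulrn_eq0 negb_or -lt0n; apply/andP; split.
  by apply/card_gt0P; exists u; rewrite inE.
by rewrite gt_eqF // sqrtr_gt0 mulr_gt0 ?exprn_gt0 ?divr_gt0 ?mulr_gt0.
Qed.

Lemma derivable_vertex_area i : derivable (fun y => A y i) x 1.
Proof.
have D : is_derive x (1 : R) (fun y => \sum_(t in T | i \in t) area E (l y) t)
    (\sum_(t in T | i \in t) 'D_1 (fun y => area E (l y) t) x).
  apply: is_derive_bigsum => t /andP[tT _].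
  by apply: derivableP; exact: derivable_area tT ell0 lE dl.
rewrite /vertex_area; under eq_fun do rewrite mulrC.
by have D' := is_deriveZ (3^-1) D; exact: ex_derive.
Qed.

(** All vertex areas agree at x, so the logarithmic derivative of their product
    is a multiple of the derivative of their sum, the total area. *)
Lemma is_derive_prod_vertex_area :
  is_derive x (1 : R) (fun y => total_area E T (l y)) 0 ->
  is_derive x (1 : R) (fun y => \prod_(a < #|V|) A y (enum_val a)) 0.
Proof.
move=> dtot; have [a0 _ aE] := vertex_area_equilateral.
have dA (a : 'I_#|V|) := derivableP (@derivable_vertex_area (enum_val a)).
apply: (is_derive_eq (is_derive_bigprod dA)).
rewrite (eq_bigr (fun a => 'D_1 (fun y => A y (enum_val a)) x * a0 ^+ #|V|.-1)).
  rewrite -mulr_suml; apply/eqP; rewrite mulf_eq0; apply/orP; left; apply/eqP.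
  have dsum : is_derive x (1 : R) (fun y => \sum_(a < #|V|) A y (enum_val a))
      (\sum_(a < #|V|) 'D_1 (fun y => A y (enum_val a)) x).
    by apply: is_derive_bigsum => a _; exact: dA.
  rewrite -[LHS](@derive_val _ _ _ _ _ _ _ dsum).
  under eq_fun => y do rewrite sum_ord_V (sum_vertex_area hM).
  exact: derive_val.
move=> a _; congr (_ * _).
rewrite (eq_bigr (fun=> a0)) => [|c _]; last exact: aE.
by rewrite prodr_const cardC1 card_ord.
Qed.

Lemma log_det'_normalized_critical :
  (\forall y \near x, total_area E T (l y) = total_area E T (l x)) ->
  is_derive x (1 : R)
    (fun y =>
       ln (det' (operator_matrix (normalized_cotan_laplace E T (l y))))) 0.
Proof.
move=> tot_cst; have [a0 a0n aE] := vertex_area_equilateral.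
have n0 := card_V_neq0 R (edge_card hM) E_sym.
set tot := total_area E T (l x).
have dtot : is_derive x (1 : R) (fun y => total_area E T (l y)) 0.
  have d0 : is_derive x (1 : R) (cst tot : R -> R) 0 by exact: is_derive_cst.
  by apply: near_eq_is_derive d0; apply: filterS tot_cst => y /= ->.
have tot0 : tot != 0.
  rewrite /tot -(sum_vertex_area hM) (eq_bigr (fun=> a0)) => [|i _]; last first.
    exact: aE.
  by rewrite sumr_const -mulr_natr mulf_neq0.
pose P y := \prod_(a < #|V|) A y (enum_val a).
have P0 : P x != 0 by apply/prodf_neq0 => a _; rewrite aE.
pose g y := (P y)^-1 * h y * (tot / #|V|%:R ^+ 2).
have dg : is_derive x (1 : R) g 0.
  have dP := is_deriveV P0 (is_derive_prod_vertex_area dtot).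
  have dc : is_derive x (1 : R) (cst (tot / #|V|%:R ^+ 2) : R -> R) 0.
    exact: is_derive_cst.
  apply: (is_derive_eq (is_deriveM (is_deriveM dP is_derive_det_cotan) dc)).
  by rewrite !scaler0 addr0 scaler0 addr0.
have g0 : g x != 0.
  by rewrite /g !mulf_neq0 ?invr_eq0 ?det_cotan_neq0 ?expf_neq0.
apply: near_eq_is_derive (is_derive_ln_critical dg g0).
have h_near := is_derive_near_neq0 is_derive_det_cotan det_cotan_neq0.
have P_near := is_derive_near_neq0 (is_derive_prod_vertex_area dtot) P0.
near=> y.
have toty : total_area E T (l y) = tot by near: y.
have hy : h y != 0 by near: y.
have Py : P y != 0 by near: y.
congr ln; apply/esym.
have sumA : \sum_(a < #|V|) A y (enum_val a) = tot.
  by rewrite sum_ord_V (sum_vertex_area hM).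
have -> : operator_matrix (normalized_cotan_laplace E T (l y))
    = \matrix_(a, b) ((A y (enum_val a))^-1 * B y a b).
  by apply/matrixP => a b; rewrite [LHS]mxE [RHS]mxE [B y a b]mxE.
rewrite det'_rescaled_zero_sums //.
- by rewrite sumA -/(P y) /g; ring.
- exact: card_V_gt0 (edge_card hM) E_sym.
- by move=> a; exact: operator_mx_row_sum.
- by move=> b; apply: operator_mx_col_sum => i j; exact: weight_sym.
- by move=> a; move/prodf_neq0: Py; apply.
- by rewrite sumA.
Unshelve. all: by end_near. Qed.

End AtEquilateral.
End Main.

Theorem theorem6p1 (R : realType) (V : finType) (E T : {set {set V}})
  (l : {set V} -> R)
  (hM : surface_triangulation E T)
  (hl : discrete_metric E T l)
  (h1 : strongly_symmetric E)
  (h2 : no_boundary E T)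
  (h3 : forall i j k : V, [set i; j; k] \in T -> angle l i j k = pi / 3)
  (I : set R) (hIopen : open I) (hIinterval : is_interval I) (hI0 : I 0)
  (lfam : R -> {set V} -> R)
  (hmetric : forall eps : R, I eps -> discrete_metric E T (lfam eps))
  (hsmooth : forall e : {set V}, e \in E ->
     smooth_on I (fun eps : R => lfam eps e))
  (hl0 : forall e : {set V}, e \in E -> lfam 0 e = l e) :
  is_derive (0 : R) (1 : R)
    (fun eps : R =>
       ln (det' (operator_matrix (cotan_laplace E T (lfam eps))))) (0 : R)
  /\
  ((forall eps eps' : R, I eps -> I eps' ->
      total_area E T (lfam eps) = total_area E T (lfam eps')) ->
   is_derive (0 : R) (1 : R)
    (fun eps : R =>
       ln (det' (operator_matrix (normalized_cotan_laplace E T (lfam eps)))))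
    (0 : R)).

Proof.
have [l0 _] := hl.
have [/set0Pn[e0 e0E] _ _] := h1.
have lE e : e \in E -> lfam 0 e = l e0.
  move=> eE; rewrite hl0 //; move: (eE) (e0E).
  have /cards2P[i [j [_ ->]]] : #|e| == 2%N by rewrite (edge_card hM).
  have /cards2P[v [w [_ ->]]] : #|e0| == 2%N by rewrite (edge_card hM).
  exact: (equiangular_const_length hM hl h3).
have dl e : e \in E -> derivable (lfam^~ e) 0 1.
  by move=> /hsmooth/(_ 0%N 0 hI0).
have ell0 := l0 _ e0E.
split; first exact: (log_det'_cotan_critical hM ell0 lE dl h1).
move=> tot_cst; apply: (log_det'_normalized_critical hM ell0 lE dl h1 h2).
have I_near : \forall y \near (0 : R), I y by exact: open_nbhs_nbhs.
by apply: filterS I_near => y Iy; exact: tot_cst.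
Qed.
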